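(* Let $\mathcal{P}=\{u_1,\dots,u_{n_1}\}$ and $\mathcal{Q}=\{v_1,\dots,v_{n_2}\}$ be nonempty finite point sets in $\mathbb{R}^d$, let $P=(u_1,\dots,u_{n_1})$ and $Q=(v_1,\dots,v_{n_2})$ be the matrices with these columns, and let $n=n_1+n_2$. Consider the problems $$\text{(SVM)}\quad\max_{w\in\mathbb{R}^d,\ s_1,s_2\in\mathbb{R}}\{s_1+s_2:\ P^Tw-s_1\mathbf{1}\ge0,\ -Q^Tw-s_2\mathbf{1}\ge0,\ \|w\|_2\le1\},$$ $$\text{(PD)}\quad\min_{\mu\in\mathbb{R}^{n_1},\ \gamma\in\mathbb{R}^{n_2}}\{\|P\mu-Q\gamma\|_2:\ \mathbf{1}^T\mu=\mathbf{1}^T\gamma=1,\ \mu,\gamma\ge0\},$$ which have a common optimal value $\mathsf{OPT}$, and assume the separable case $\mathsf{OPT}>0$. Let $D$ be the maximum Euclidean norm of the points in $\mathcal{P}\cup\mathcal{Q}$ and $E=D^2/\mathsf{OPT}^2$. Let $\varepsilon\in(0,1]$. Then the primal-dual meta-algorithm applied to (SVM) (described in the context) computes a $(1-\varepsilon)$-approximate solution to (SVM) and a $(1+\varepsilon)$-approximate solution to (PD) in $O\Big(\frac{E\,nd\log n}{\varepsilon^2}\Big)$ time.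
   Context: Time is the number of elementary operations on real numbers (arithmetic, comparisons, square roots, exponentials), and the constant in $O(\cdot)$ is absolute. A $(1-\varepsilon)$-approximate solution to (SVM) is a feasible point with objective value at least $(1-\varepsilon)\mathsf{OPT}$; a $(1+\varepsilon)$-approximate solution to (PD) is a feasible point with objective value at most $(1+\varepsilon)\mathsf{OPT}$. $\mathbf{1}$ is the all-ones vector of the appropriate length. The meta-algorithm for this problem. The redundant constraints $s_1\le D$, $s_2\le D$ are added to (SVM). Feasibility test for a guess $\alpha\in(0,2D]$ and tolerance $\varepsilon'$: put $R=2$, $\rho=2D$, $T=\lceil4R^2\rho^2\ln n/(\varepsilon'^2\alpha^2)\rceil$, $\eta=\sqrt{\ln n/T}$. Start with $p^{(1)}=\frac1n\mathbf{1}\in\mathbb{R}^n_+$. In iteration $t=1,\dots,T$, write $p^{(t)}=(\mu^{(t)};\gamma^{(t)})$ with $\mu^{(t)}\in\mathbb{R}^{n_1}_+$, $\gamma^{(t)}\in\mathbb{R}^{n_2}_+$, and solve (in closed form) $$\max_{w,s_1,s_2}\ (P\mu^{(t)}-Q\gamma^{(t)})^Tw-(\mathbf{1}^T\mu^{(t)})s_1-(\mathbf{1}^T\gamma^{(t)})s_2\quad\text{s.t. }s_1+s_2\ge\alpha,\ \|w\|_2\le1,\ s_1,s_2\le D .$$ If the value is negative, conclude $\mathsf{OPT}<\alpha$, output $\big(\mu^{(t)}/(\mathbf{1}^T\mu^{(t)});\ \gamma^{(t)}/(\mathbf{1}^T\gamma^{(t)})\big)$ as a solution of (PD), and terminate.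 Otherwise let $(w^{(t)},s_1^{(t)},s_2^{(t)})$ be the optimal solution found, let $\bar w^{(t)},\bar s_1^{(t)},\bar s_2^{(t)}$ be the averages over iterations $1,\dots,t$, and set $p^{(t+1)}=\frac1C\exp\big(-\frac{\eta t}{\rho}(P^T\bar w^{(t)}-\bar s_1^{(t)}\mathbf{1};\ -Q^T\bar w^{(t)}-\bar s_2^{(t)}\mathbf{1})\big)$ (entrywise exponential, $C$ normalizing the entries to sum to one). If there is no termination within $T$ iterations, output $(\bar w^{(T)},\ \bar s_1^{(T)}-\varepsilon'\alpha/2,\ \bar s_2^{(T)}-\varepsilon'\alpha/2)$ as a solution of (SVM), of value at least $(1-\varepsilon')\alpha$. Search over $\alpha$: starting from an interval $[L_0,U_0]=[0,2D]$ containing $\mathsf{OPT}$, repeatedly run the feasibility test with a guess $\alpha_i$ and tolerance $\varepsilon_i$ chosen so that $\varepsilon_i\alpha_i=\frac13(U_{i-1}-L_{i-1})$ and $[(1-\varepsilon_i)\alpha_i,\alpha_i]$ is the middle third of the current interval $[L_{i-1},U_{i-1}]$; if $\mathsf{OPT}<\alpha_i$ is concluded set $U_i=\alpha_i$, $L_i=L_{i-1}$, otherwise set $L_i=(1-\varepsilon_i)\alpha_i$, $U_i=U_{i-1}$; continue until $U_i-L_i$ is at most the desired additive error $\varepsilon\,\mathsf{OPT}$. The last solutions found for (SVM) and (PD) are returned (initially, $w=0,s_1=s_2=0$ for (SVM) and any feasible point for (PD)). *)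

(* Defs.v *)
From mathcomp Require Import all_boot all_order all_algebra.
From mathcomp Require Import classical_sets reals sequences exp.
From mathcomp Require Import lra.

Set Implicit Arguments.
Unset Strict Implicit.
Unset Printing Implicit Defensive.
Import Order.TTheory GRing.Theory Num.Theory.
Local Open Scope classical_set_scope.
Local Open Scope ring_scope.

(** * The two problems
    The points are the columns of [P] and [Q]. *)

Definition norm2 (R : realType) (d : nat) (v : 'cV[R]_d) : R :=
  Num.sqrt (\sum_i v i 0 ^+ 2).

Definition dot (R : realType) (d : nat) (u v : 'cV[R]_d) : R :=
  \sum_i u i 0 * v i 0.

Definition total (R : realType) (n : nat) (v : 'cV[R]_n) : R := \sum_i v i 0.

Definition nonneg (R : realType) (n : nat) (v : 'cV[R]_n) : Prop :=
  forall i, 0 <= v i 0.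

Record svm_pt (R : realType) (d : nat) :=
  SvmPt { sw : 'cV[R]_d; s1 : R; s2 : R }.

Record pd_pt (R : realType) (n1 n2 : nat) :=
  PdPt { pmu : 'cV[R]_n1; pgamma : 'cV[R]_n2 }.

Section Problems.
Variables (R : realType) (d n1 n2 : nat).
Variables (P : 'M[R]_(d, n1)) (Q : 'M[R]_(d, n2)).
Implicit Types (x : svm_pt R d) (y : pd_pt R n1 n2).

Definition svm_obj x : R := s1 x + s2 x.

Definition svm_feasible x : Prop :=
  [/\ nonneg (P^T *m sw x - const_mx (s1 x)),
      nonneg (- (Q^T *m sw x) - const_mx (s2 x)) &
      norm2 (sw x) <= 1].

Definition svm_opt : R := sup [set svm_obj x | x in [set x | svm_feasible x]].

Definition svm_approx (eps : R) x : Prop :=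
  svm_feasible x /\ (1 - eps) * svm_opt <= svm_obj x.

Definition pd_obj y : R := norm2 (P *m pmu y - Q *m pgamma y).

Definition pd_feasible y : Prop :=
  [/\ total (pmu y) = 1, total (pgamma y) = 1,
      nonneg (pmu y) & nonneg (pgamma y)].

Definition pd_opt : R := inf [set pd_obj y | y in [set y | pd_feasible y]].

Definition pd_approx (eps : R) y : Prop :=
  pd_feasible y /\ pd_obj y <= (1 + eps) * pd_opt.

Definition max_norm : R :=
  Num.max (\big[Num.max/0]_j norm2 (col j P)) (\big[Num.max/0]_j norm2 (col j Q)).

End Problems.

(** * Counting operations on real numbers
    [tm A] is a result together with the number of real operations spent on
    it.  Real numbers are only ever combined through the operations below;
    reading an entry of a vector, assembling or splitting vectors, and program
    constants are free. *)

Record tm (A : Type) := Tm { cost : nat; val : A }.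
Arguments Tm {A}.

Declare Scope tm_scope.
Delimit Scope tm_scope with tm.
Bind Scope tm_scope with tm.

Definition ret (A : Type) (a : A) : tm A := Tm 0 a.

Definition bind (A B : Type) (e : tm A) (k : A -> tm B) : tm B :=
  Tm (cost e + cost (k (val e))) (val (k (val e))).

Notation "$ x" := (ret x%R) (at level 2, format "$ x") : tm_scope.
Notation "'let*' x ':=' e 'in' k" := (bind e%tm (fun x => k%tm))
  (at level 200, x name, e at level 200, k at level 200, right associativity).

Section Operations.
Variable R : realType.

Definition op1 (A : Type) (f : R -> A) (a : tm R) : tm A :=
  Tm (cost a).+1 (f (val a)).
Definition op2 (A : Type) (f : R -> R -> A) (a b : tm R) : tm A :=
  Tm (cost a + cost b).+1 (f (val a) (val b)).

Definition t_add := op2 (fun a b : R => a + b).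
Definition t_sub := op2 (fun a b : R => a - b).
Definition t_mul := op2 (fun a b : R => a * b).
Definition t_div := op2 (fun a b : R => a / b).
Definition t_opp := op1 (fun a : R => - a).
Definition t_sqrt := op1 (fun a : R => Num.sqrt a).
Definition t_exp := op1 (fun a : R => expR a).
(* needed only for [ln n], once per feasibility test *)
Definition t_ln := op1 (fun a : R => ln a).
Definition t_le := op2 (fun a b : R => a <= b).
Definition t_lt := op2 (fun a b : R => a < b).

(* A counter read as a real: the real copy is updated by one addition each time
   the counter moves. *)
Definition t_nat (k : nat) : tm R := Tm 1 k%:R.

(* Least natural number [k >= a], for [a > -1], found by counting up from 0:
   [k] increments and [k + 1] comparisons. *)
Definition t_ceil (a : tm R) : tm nat :=
  let k := `|Num.ceil (val a)|%N in Tm (cost a + (2 * k).+1) k.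

Definition t_vec (n : nat) (f : 'I_n -> tm R) : tm 'cV[R]_n :=
  Tm (\sum_i cost (f i)) (\col_i val (f i)).

Definition t_sum (n : nat) (f : 'I_n -> tm R) : tm R :=
  Tm (\sum_i (cost (f i)).+1) (\sum_i val (f i)).

Definition t_max (n : nat) (f : 'I_n -> tm R) : tm R :=
  Tm (\sum_i (cost (f i)).+1) (\big[Num.max/0]_i val (f i)).

End Operations.

Notation "a + b" := (t_add a b) : tm_scope.
Notation "a - b" := (t_sub a b) : tm_scope.
Notation "a * b" := (t_mul a b) : tm_scope.
Notation "a / b" := (t_div a b) : tm_scope.
Notation "- a" := (t_opp a) : tm_scope.
Arguments t_vec {R n} f.
Arguments t_sum {R n} f.
Arguments t_max {R n} f.
Arguments t_nat {R} k.
Notation "\vec_ i e" := (t_vec (fun i => e%tm))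
  (at level 36, i at level 0, e at level 36) : tm_scope.
Notation "\tsum_ i e" := (t_sum (fun i => e%tm))
  (at level 36, i at level 0, e at level 36) : tm_scope.
Notation "\tmax_ i e" := (t_max (fun i => e%tm))
  (at level 36, i at level 0, e at level 36) : tm_scope.

Section VectorOperations.
Variable R : realType.

Definition t_dot (n : nat) (u v : 'cV[R]_n) : tm R :=
  (\tsum_i ($(u i 0) * $(v i 0)))%tm.
Definition t_norm (n : nat) (v : 'cV[R]_n) : tm R := t_sqrt (t_dot v v).
Definition t_mulmx (m n : nat) (A : 'M[R]_(m, n)) (v : 'cV[R]_n) :
    tm 'cV[R]_m :=
  (\vec_i \tsum_j ($(A i j) * $(v j 0)))%tm.
Definition t_total (n : nat) (v : 'cV[R]_n) : tm R :=
  (\tsum_i $(v i 0))%tm.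
Definition t_scaledown (n : nat) (v : 'cV[R]_n) (a : R) : tm 'cV[R]_n :=
  (\vec_i ($(v i 0) / $a))%tm.

End VectorOperations.

(** * The algorithm *)

(* [while_not stop body s c s']: the loop "until [stop], do [body]" started in
   state [s] terminates in state [s'] after [c] operations. *)
Inductive while_not (S : Type) (stop : S -> tm bool) (body : S -> tm S) :
    S -> nat -> S -> Prop :=
| while_not_stop s :
    val (stop s) = true -> while_not stop body s (cost (stop s)) s
| while_not_step s c s' :
    val (stop s) = false -> while_not stop body (val (body s)) c s' ->
    while_not stop body s (cost (stop s) + cost (body s) + c)%N s'.

(* The search ends once [U - L] is at most the desired additive error
   [eps * OPT].  [Exact_gap] takes that number literally, as a target given to
   the algorithm; [Certified_gap] is the test available when [OPT] is unknown,
   with the lower bound [L <= OPT] in its place. *)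
Variant stop_rule := Exact_gap | Certified_gap.

Section Algorithm.
Variables (R : realType) (d n1 n2 : nat).
Variables (P : 'M[R]_(d, n1)) (Q : 'M[R]_(d, n2)).
Notation n := (n1 + n2)%N.

Definition sub_feasible (D alpha : R) (x : svm_pt R d) : Prop :=
  [/\ alpha <= s1 x + s2 x, norm2 (sw x) <= 1, s1 x <= D & s2 x <= D].

Definition sub_obj (mu : 'cV[R]_n1) (gamma : 'cV[R]_n2) (x : svm_pt R d) : R :=
  dot (P *m mu - Q *m gamma) (sw x) - total mu * s1 x - total gamma * s2 x.

(* Closed-form optimal solution and its value (see [sub_solve_optimal]): [w] is
   the normalized [P mu - Q gamma], and the [s_i] of smaller weight is [D]. *)
Definition sub_solve (D alpha : R) (mu : 'cV[R]_n1) (gamma : 'cV[R]_n2) :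
    tm (svm_pt R d * R) :=
  let* a := t_mulmx P mu in
  let* b := t_mulmx Q gamma in
  let* g := \vec_i ($(a i 0) - $(b i 0)) in
  let* gn := t_norm g in
  let* pos := t_lt $0 $gn in
  let* w := if pos then t_scaledown g gn else $0 in
  let* m1 := t_total mu in
  let* m2 := t_total gamma in
  let* s := $alpha - $D in
  let* heavy1 := t_le $m2 $m1 in
  let x := if heavy1 then SvmPt w s D else SvmPt w D s in
  let* v := t_dot g w - $m1 * $(s1 x) - $m2 * $(s2 x) in
  ret (x, v).

(* p^(t+1) from the averages [x] over the iterations 1, ..., t *)
Definition weights (eta rho : R) (t : nat) (x : svm_pt R d) : tm 'cV[R]_n :=
  let* a := t_mulmx P^T (sw x) in
  let* b := t_mulmx Q^T (sw x) in
  let* za := \vec_i ($(a i 0) - $(s1 x)) in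
  let* zb := \vec_i (- $(b i 0) - $(s2 x)) in
  let z := col_mx za zb in
  let* c := $eta * t_nat t / $rho in
  let* e := \vec_i (t_exp (- ($c * $(z i 0)))) in
  let* C := t_total e in
  t_scaledown e C.

Variant outcome :=
| Below_guess of pd_pt R n1 n2   (* OPT < alpha *)
| Solution of svm_pt R d.

(* Iterations [t], ..., [t + k - 1]; [acc] is the sum and [avg] the average of
   the subproblem solutions of the iterations before [t], and [ea] is
   [eps' * alpha]. *)
Fixpoint iterations (D alpha ea eta rho : R) (k t : nat) (p : 'cV[R]_n)
    (acc avg : svm_pt R d) {struct k} : tm outcome :=
  if k is k'.+1 then
    let mu := usubmx p in
    let gamma := dsubmx p in
    let* xv := sub_solve D alpha mu gamma in
    let* neg := t_lt $(xv.2) $0 in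
    if neg then
      let* m1 := t_total mu in
      let* m2 := t_total gamma in
      let* mu' := t_scaledown mu m1 in
      let* gamma' := t_scaledown gamma m2 in
      ret (Below_guess (PdPt mu' gamma'))
    else
      let x := xv.1 in
      let* w := \vec_i ($(sw acc i 0) + $(sw x i 0)) in
      let* a1 := $(s1 acc) + $(s1 x) in
      let* a2 := $(s2 acc) + $(s2 x) in
      let* tR := t_nat t in
      let* wbar := t_scaledown w tR in
      let* s1bar := $a1 / $tR in
      let* s2bar := $a2 / $tR in
      let avg' := SvmPt wbar s1bar s2bar in
      let* p' := weights eta rho t avg' in
      iterations D alpha ea eta rho k' t.+1 p' (SvmPt w a1 a2) avg'
  else
    let* h := $ea / $2 in
    let* r1 := $(s1 avg) - $h in
    let* r2 := $(s2 avg) - $h in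
    ret (Solution (SvmPt (sw avg) r1 r2)).

(* [T = ceil (4 R^2 rho^2 ln n / (eps'^2 alpha^2))] with [R = 2], and
   [eta = sqrt (ln n / T)] *)
Definition feasibility_test (D alpha eps' : R) : tm outcome :=
  let* rho := $2 * $D in
  let* ea := $eps' * $alpha in
  let* lnn := t_ln (t_nat n) in
  let* T := t_ceil ($(4 * 2 ^+ 2) * ($rho * $rho) * $lnn / ($ea * $ea)) in
  let* eta := t_sqrt ($lnn / t_nat T) in
  let* p1 := \vec_i ($1 / t_nat n) in
  let zero := SvmPt 0 0 0 in
  iterations D alpha ea eta rho T 1 p1 zero zero.

Record search_state := SearchState {
  lo : R; up : R; svm_sol : svm_pt R d; pd_sol : pd_pt R n1 n2 }.

(* [((1 - eps') * alpha, alpha)] is the middle third of [(lo st, up st)]. *)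
Definition search_body (D : R) (st : search_state) : tm search_state :=
  let* third := ($(up st) - $(lo st)) / $3 in
  let* alpha := $(up st) - $third in
  let* eps' := $third / $alpha in
  let* o := feasibility_test D alpha eps' in
  match o with
  | Below_guess y => ret (SearchState (lo st) alpha (svm_sol st) y)
  | Solution x =>
      let* l := ($1 - $eps') * $alpha in
      ret (SearchState l (up st) x (pd_sol st))
  end.

Definition search_stop (rule : stop_rule) (eps : R) (st : search_state) :
    tm bool :=
  let bound := if rule is Exact_gap then svm_opt P Q else lo st in
  t_le ($(up st) - $(lo st)) ($eps * $bound).

Definition t_max_norm : tm R :=
  let* a := \tmax_j (t_norm (col j P)) in
  let* b := \tmax_j (t_norm (col j Q)) in
  let* c := t_le $a $b in
  ret (if c then b else a).

(* The algorithm, with starting point [y0] for (PD), stops after [time] real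
   operations and returns [x] and [y]. *)
Definition meta_algorithm (rule : stop_rule) (eps : R) (y0 : pd_pt R n1 n2)
    (time : nat) (x : svm_pt R d) (y : pd_pt R n1 n2) : Prop :=
  let start := (let* D := t_max_norm in
                let* u := $2 * $D in
                ret (D, SearchState 0 u (SvmPt 0 0 0) y0)) in
  exists c st,
    [/\ while_not (search_stop rule eps) (search_body (val start).1)
          (val start).2 c st,
        time = (cost start + c)%N, x = svm_sol st & y = pd_sol st].

End Algorithm.

(** * Correctness of the closed form *)

Lemma norm2_ge0 (R : realType) (d : nat) (v : 'cV[R]_d) : 0 <= norm2 v.
Proof. exact: sqrtr_ge0. Qed.

Lemma norm2_sqr (R : realType) (d : nat) (v : 'cV[R]_d) :
  norm2 v ^+ 2 = dot v v.
Proof.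
by rewrite sqr_sqrtr ?sumr_ge0 // => i _; rewrite sqr_ge0.
Qed.

Lemma dot_le_norm (R : realType) (d : nat) (g w : 'cV[R]_d) :
  norm2 w <= 1 -> dot g w <= norm2 g.
Proof.
move=> hw; have hg := norm2_ge0 g; set c := norm2 g in hg *.
have key : 0 <= dot g g - (c * dot g w) *+ 2 + c ^+ 2 * dot w w.
  suff -> : dot g g - (c * dot g w) *+ 2 + c ^+ 2 * dot w w =
      \sum_i (g i 0 - c * w i 0) ^+ 2.
    by apply: sumr_ge0 => i _; rewrite sqr_ge0.
  rewrite /dot !mulr_sumr -sumrMnl -sumrB -big_split /=.
  apply: eq_bigr => i _; rewrite sqrrB exprMn -!expr2 mulrCA mulrA.
  by rewrite mulrC mulrA (mulrC (w i 0)).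
have hww : dot w w <= 1 by rewrite -norm2_sqr expr_le1 ?norm2_ge0.
move: key; rewrite -norm2_sqr -/c => key.
have hc : c * dot g w <= c * c.
  have h1 : c ^+ 2 * dot w w <= c ^+ 2.
    by rewrite -[leRHS]mulr1 ler_wpM2l ?sqr_ge0.
  by rewrite -expr2; nra.
case: (ltrgtP 0 c) hg => // [c0|c0] _; first by rewrite -(ler_pM2l c0).
have gz : dot g g = 0 by rewrite -norm2_sqr -/c -c0 expr0n.
have g0 i : g i 0 = 0.
  apply/eqP; rewrite -(mulf_eq0 (g i 0) (g i 0)) orbb || rewrite -sqrf_eq0 expr2.
  by move/eqP: gz; rewrite psumr_eq0 => [/allP/(_ i (mem_index_enum i))|j _];
    rewrite -?expr2 ?sqr_ge0.
by rewrite /dot big1 -?c0 // => i _; rewrite g0 mul0r.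
Qed.

Lemma sub_solve_optimal (R : realType) (d n1 n2 : nat)
    (P : 'M[R]_(d, n1)) (Q : 'M[R]_(d, n2)) (D alpha : R)
    (mu : 'cV[R]_n1) (gamma : 'cV[R]_n2) :
  nonneg mu -> nonneg gamma -> alpha <= 2 * D ->
  let xv := val (sub_solve P Q D alpha mu gamma) in
  [/\ sub_feasible D alpha xv.1, xv.2 = sub_obj P Q mu gamma xv.1 &
      forall x, sub_feasible D alpha x -> sub_obj P Q mu gamma x <= xv.2].
Proof.
move=> mu0 ga0 aD; pose g := P *m mu - Q *m gamma.
pose w := val (if 0 < norm2 g then t_scaledown g (norm2 g) else ret 0).
pose x0 := if total gamma <= total mu then SvmPt w (alpha - D) D
  else SvmPt w D (alpha - D).
have -> : val (sub_solve P Q D alpha mu gamma) =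
    (x0, dot g w - total mu * s1 x0 - total gamma * s2 x0).
  rewrite /x0 /w; have -> : g = \col_i ((\col_i \sum_j P i j * mu j 0) i 0 -
      (\col_i \sum_j Q i j * gamma j 0) i 0).
    by apply/colP => i; rewrite !mxE.
  by [].
have m10 : 0 <= total mu by apply: sumr_ge0.
have m20 : 0 <= total gamma by apply: sumr_ge0.
have [w1 gw] : norm2 w <= 1 /\ dot g w = norm2 g.
  rewrite /w; case: ifPn => [gp|]; last first.
    rewrite -leNgt => g0; have {}g0 : norm2 g = 0.
      by apply/eqP; rewrite eq_le g0 norm2_ge0.
    rewrite g0 /=; split; last first.
      by rewrite /dot big1 // => i _; rewrite [X in _ * X]mxE mulr0.
    by rewrite /norm2 big1 ?sqrtr0 ?ler01 // => i _; rewrite mxE expr2 mulr0.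
  have e : val (t_scaledown g (norm2 g)) = (norm2 g)^-1 *: g.
    by apply/colP => i; rewrite mxE [RHS]mxE mulrC.
  have dE : dot g ((norm2 g)^-1 *: g) = norm2 g.
    rewrite /dot; under eq_bigr do rewrite [X in _ * X]mxE mulrCA.
    by rewrite -mulr_sumr -/(dot g g) -norm2_sqr expr2 mulKf ?gt_eqF.
  split; last by rewrite e dE.
  rewrite e -(expr_le1 (n := 2)) ?norm2_ge0 // norm2_sqr.
  rewrite /dot; under eq_bigr do rewrite [X in X * _]mxE -mulrA.
  by rewrite -mulr_sumr -/(dot g _) dE mulVf ?gt_eqF.
split=> [||[x t1 t2] [/= h1 h2 h3 h4]].
- by rewrite /x0; split; case: ifP => _ //=; lra.
- by rewrite /sub_obj /x0; case: ifP.
have := dot_le_norm g h2; rewrite /sub_obj gw /= -/g => hx.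
by rewrite /x0; case: ifPn => [h|]; rewrite -?ltNge => * /=; nra.
Qed.

(* Main.v *)
(** Each feasibility test is a Hedge run on the margins of the constraints of
    (SVM), and the potential [sum_i exp(- eta / rho * margin_i)] of the summed
    subproblem solutions grows by a factor of at most [exp(eta^2)] per
    iteration, because a nonnegative subproblem value is a nonnegative
    [p]-weighted margin.  After [T] iterations this bounds every average margin
    below by [- 2 rho eta >= - eps' alpha / 2].  A negative subproblem value
    instead certifies that the normalized [p] has (PD) value at most [alpha].

    The gap of the search shrinks by [2/3] per test and a test costs
    [O(n d D^2 ln n / gap^2)], so the costs form a geometric sum dominated by
    the last test, whose gap exceeds [eps * OPT / 2] under either stopping rule.
    Strong duality is itself a consequence: the search produces feasible points
    of (PD) with values arbitrarily close to the optimum of (SVM). *)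

Require Import Defs.
From mathcomp Require Import all_boot all_order all_algebra.
From mathcomp Require Import classical_sets reals sequences exp.
From mathcomp Require Import lra ring zify.
(* Restores [total], which the preceding imports shadow. *)
Import Defs.
Import Order.TTheory GRing.Theory Num.Theory.
Local Open Scope ring_scope.

Set Implicit Arguments.
Unset Strict Implicit.
Unset Printing Implicit Defensive.

(** * Inner products and the Euclidean norm *)

Section Vectors.
Variable R : realType.
Implicit Types (d m n : nat).

Lemma dotC d (u v : 'cV[R]_d) : dot u v = dot v u.
Proof. by apply: eq_bigr => i _; rewrite mulrC. Qed.

Lemma dotDr d (u v w : 'cV[R]_d) : dot u (v + w) = dot u v + dot u w.
Proof. by rewrite -big_split; apply: eq_bigr => i _; rewrite mxE mulrDr. Qed.

Lemma dotZr d a (u v : 'cV[R]_d) : dot u (a *: v) = a * dot u v.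
Proof. by rewrite mulr_sumr; apply: eq_bigr => i _; rewrite mxE mulrCA. Qed.

Lemma dotNr d (u v : 'cV[R]_d) : dot u (- v) = - dot u v.
Proof. by rewrite -scaleN1r dotZr mulN1r. Qed.

Lemma dotBl d (u v w : 'cV[R]_d) : dot (u - v) w = dot u w - dot v w.
Proof. by rewrite dotC dotDr dotNr !(dotC w). Qed.

Lemma dotZl d a (u v : 'cV[R]_d) : dot (a *: u) v = a * dot u v.
Proof. by rewrite dotC dotZr dotC. Qed.

Lemma dot0r d (u : 'cV[R]_d) : dot u 0 = 0.
Proof. by rewrite -(scale0r 0) dotZr mul0r. Qed.

Lemma dot_const_mx d (u : 'cV[R]_d) a : dot u (const_mx a) = total u * a.
Proof. by rewrite mulr_suml; apply: eq_bigr => i _; rewrite mxE. Qed.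

Lemma dot_mulmx m n (A : 'M[R]_(m, n)) v w :
  dot (A *m v) w = dot v (A^T *m w).
Proof.
rewrite /dot; under eq_bigr do rewrite mxE mulr_suml.
rewrite exchange_big; apply: eq_bigr => j _; rewrite mxE mulr_sumr.
by apply: eq_bigr => i _; rewrite mxE mulrCA mulrA.
Qed.

Lemma dot_col_mx m n (p : 'cV[R]_(m + n)) a b :
  dot p (col_mx a b) = dot (usubmx p) a + dot (dsubmx p) b.
Proof.
rewrite /dot big_split_ord; congr (_ + _); apply: eq_bigr => i _.
  by rewrite col_mxEu mxE.
by rewrite col_mxEd mxE.
Qed.

Lemma totalZ n a (v : 'cV[R]_n) : total (a *: v) = a * total v.
Proof. by rewrite mulr_sumr; apply: eq_bigr => i _; rewrite mxE. Qed.

Lemma trmx_mulmx_dot m n (A : 'M[R]_(m, n)) w j :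
  (A^T *m w) j 0 = dot (col j A) w.
Proof. by rewrite mxE; apply: eq_bigr => i _; rewrite !mxE. Qed.

Lemma norm2_0 d : norm2 (0 : 'cV[R]_d) = 0.
Proof. by rewrite /norm2 big1 ?sqrtr0 // => i _; rewrite mxE expr0n. Qed.

(** Equality case of Cauchy-Schwarz: normalize [g], or take [0] when [g] has norm zero. It lets a
    norm be bounded by testing against unit vectors. *)
Lemma dot_norm2_attained d (g : 'cV[R]_d) :
  exists2 w, norm2 w <= 1 & dot g w = norm2 g.
Proof.
case: (ltrgtP 0 (norm2 g)) (norm2_ge0 g) => // [g0|g0] _; last first.
  by exists 0; rewrite ?dot0r ?norm2_0.
have dE : dot g ((norm2 g)^-1 *: g) = norm2 g.
  by rewrite dotZr -norm2_sqr expr2 mulKf ?gt_eqF.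
exists ((norm2 g)^-1 *: g) => //.
rewrite -(expr_le1 (n := 2)) ?norm2_ge0 // norm2_sqr dotZl dE.
by rewrite mulVf ?gt_eqF.
Qed.

Lemma dot_ge_Nnorm d (g w : 'cV[R]_d) : norm2 w <= 1 -> - norm2 g <= dot g w.
Proof.
move=> w1; rewrite lerNl -dotNr; apply: dot_le_norm.
suff -> : norm2 (- w) = norm2 w by [].
by rewrite /norm2; under eq_bigr do rewrite mxE sqrrN.
Qed.

Lemma dot_weighted_le n (mu a : 'cV[R]_n) D :
  nonneg mu -> (forall j, a j 0 <= D) -> dot mu a <= total mu * D.
Proof.
by move=> mu0 aD; rewrite mulr_suml; apply: ler_sum => j _; exact: ler_wpM2l.
Qed.

End Vectors.

(** From [expR (- (x / 2)) >= 1 - x / 2 > 0] one gets [expR x <= (1 - x / 2) ^- 2], and comparing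
    this with the quadratic reduces to [1 - 3 * x + x ^+ 2 >= 0], true up to [1 / 4]. *)
Lemma expR_le_quadratic (R : realType) (x : R) :
  x <= 1 / 4 -> expR x <= 1 + x + x ^+ 2.
Proof.
move=> x4; set y := expR (- (x / 2)).
have y0 : 0 < y by exact: expR_gt0.
have yx : 1 - x / 2 <= y by exact: expR_ge1Dx.
have xyy : expR x * y ^+ 2 = 1.
  by rewrite expr2 /y -!expRD -[RHS]expR0; congr expR; field.
have h : (1 - x / 2) ^+ 2 <= y ^+ 2.
  by rewrite lerXn2r // nnegrE; lra.
have e0 := expR_gt0 x.
have h2 : expR x * (1 - x / 2) ^+ 2 <= 1 by rewrite -[leRHS]xyy ler_pM2l.
have h3 : 1 <= (1 + x + x ^+ 2) * (1 - x / 2) ^+ 2.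
  have -> : (1 + x + x ^+ 2) * (1 - x / 2) ^+ 2 =
    1 + (x / 2) ^+ 2 * (1 - 3 * x + x ^+ 2) by field.
  have : 0 <= (x / 2) ^+ 2 by exact: sqr_ge0.
  have : 0 <= 1 - 3 * x + x ^+ 2 by nra.
  by move=> ? ?; nra.
have h4 : 0 < (1 - x / 2) ^+ 2 by rewrite exprn_gt0 //; lra.
by rewrite -(ler_pM2r h4); exact: le_trans h2 h3.
Qed.

(** * Constraint slacks, weak duality and certificates for (PD) *)

Section Points.
Variables (R : realType) (d n1 n2 : nat).
Variables (P : 'M[R]_(d, n1)) (Q : 'M[R]_(d, n2)).
Implicit Types (x : svm_pt R d) (y : pd_pt R n1 n2).

Definition pt_add x x' : svm_pt R d :=
  SvmPt (sw x + sw x') (s1 x + s1 x') (s2 x + s2 x').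

Definition pt_scale (a : R) x : svm_pt R d :=
  SvmPt (a *: sw x) (a * s1 x) (a * s2 x).

(** The slacks of the linear constraints, one per point. They are linear in [x] and serve as the
    losses of the Hedge run. *)
Definition margins x : 'cV[R]_(n1 + n2) :=
  col_mx (P^T *m sw x - const_mx (s1 x)) (- (Q^T *m sw x) - const_mx (s2 x)).

Lemma margins_add x x' : margins (pt_add x x') = margins x + margins x'.
Proof.
rewrite /margins add_col_mx /= !mulmxDr !raddfD /=.
by congr col_mx; apply/colP => i; rewrite !mxE; ring.
Qed.

Lemma margins_scale a x : margins (pt_scale a x) = a *: margins x.
Proof.
rewrite /margins scale_col_mx /= -!scalemxAr.
by congr col_mx; apply/colP => i; rewrite !mxE; ring.
Qed.

Lemma marginsE x i :
  margins x i 0 = match split i with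
    | inl j => dot (col j P) (sw x) - s1 x
    | inr j => - dot (col j Q) (sw x) - s2 x end.
Proof.
rewrite -{1}(splitK i); case: (split i) => j /=; rewrite -trmx_mulmx_dot.
  by rewrite col_mxEu [LHS]mxE; congr (_ + _); rewrite !mxE.
by rewrite col_mxEd [LHS]mxE; congr (_ + _); rewrite mxE // mxE.
Qed.

Lemma margins_shift x h i :
  margins (SvmPt (sw x) (s1 x - h) (s2 x - h)) i 0 = margins x i 0 + h.
Proof.
by rewrite !marginsE; case: split => j /=; ring.
Qed.

(** Cauchy-Schwarz gives [D] for the inner product, and the offset adds another [D]; this is the
    width [rho = 2 * D]. *)
Lemma margins_bound D x i : 0 <= D ->
  (forall j, norm2 (col j P) <= D) -> (forall j, norm2 (col j Q) <= D) ->
  norm2 (sw x) <= 1 -> - D <= s1 x <= D -> - D <= s2 x <= D ->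
  - (2 * D) <= margins x i 0 <= 2 * D.
Proof.
move=> D0 PD QD w1 /andP[a1 b1] /andP[a2 b2].
rewrite marginsE; case: (split i) => j.
  have := dot_le_norm (col j P) w1; have := dot_ge_Nnorm (col j P) w1.
  by have := PD j => *; lra.
have := dot_le_norm (col j Q) w1; have := dot_ge_Nnorm (col j Q) w1.
by have := QD j => *; lra.
Qed.

Lemma svm_feasible_margins x :
  nonneg (margins x) -> norm2 (sw x) <= 1 -> svm_feasible P Q x.
Proof.
move=> h w1; split=> // i; first by have := h (lshift n2 i); rewrite col_mxEu.
by have := h (rshift n1 i); rewrite col_mxEd.
Qed.

(** The subproblem objective is the Lagrangian of (SVM): the slacks weighted by the multipliers. *)
Lemma sub_obj_margins (mu : 'cV[R]_n1) (gamma : 'cV[R]_n2) x :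
  sub_obj P Q mu gamma x = dot (col_mx mu gamma) (margins x).
Proof.
rewrite dot_col_mx col_mxKu col_mxKd !dotDr !dotNr !dot_const_mx.
rewrite /sub_obj dotBl !dot_mulmx; ring.
Qed.

(** The Lagrangian at [y] is nonnegative, and since the multipliers have unit totals it is at most
    [pd_obj P Q y - svm_obj x]. *)
Lemma weak_duality x y :
  svm_feasible P Q x -> pd_feasible y -> svm_obj x <= pd_obj P Q y.
Proof.
move=> [h1 h2 w1] [t1 t2 p1 p2].
have : 0 <= sub_obj P Q (pmu y) (pgamma y) x.
  rewrite sub_obj_margins dot_col_mx col_mxKu col_mxKd.
  by rewrite addr_ge0 // sumr_ge0 // => i _; rewrite mulr_ge0.
have := dot_le_norm (P *m pmu y - Q *m pgamma y) w1.
by rewrite /sub_obj t1 t2 /svm_obj /pd_obj; lra.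
Qed.

Lemma svm_feasible0 : svm_feasible P Q (SvmPt 0 0 0).
Proof.
by split=> [i|i|] /=; rewrite ?norm2_0 ?ler01 // !mulmx0 !mxE; lra.
Qed.

Lemma norm2_le_of_dot (g : 'cV[R]_d) (a : R) :
  (forall w, norm2 w <= 1 -> dot g w <= a) -> norm2 g <= a.
Proof. by have [w w1 <-] := dot_norm2_attained g; apply. Qed.

Lemma dot_mulmx_bound m (A : 'M[R]_(d, m)) (mu : 'cV[R]_m) w D :
  (forall j, norm2 (col j A) <= D) -> nonneg mu -> norm2 w <= 1 ->
  `|dot (A *m mu) w| <= total mu * D.
Proof.
move=> AD mu0 w1; rewrite dot_mulmx ler_norml; apply/andP; split.
  rewrite lerNl -dotNr; apply: dot_weighted_le => // j.
  rewrite mxE trmx_mulmx_dot lerNl; apply: le_trans (dot_ge_Nnorm _ w1).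
  by rewrite lerN2.
apply: dot_weighted_le => // j.
by rewrite trmx_mulmx_dot; exact: le_trans (dot_le_norm _ w1) _.
Qed.

(** Any feasible starting point certifies the initial upper end [2 * D] of the search. *)
Lemma pd_obj_le_max_norm D y :
  (forall j, norm2 (col j P) <= D) -> (forall j, norm2 (col j Q) <= D) ->
  pd_feasible y -> pd_obj P Q y <= 2 * D.
Proof.
move=> PD QD [t1 t2 p1 p2]; apply: norm2_le_of_dot => w w1.
have := dot_mulmx_bound PD p1 w1; have := dot_mulmx_bound QD p2 w1.
by rewrite dotBl t1 t2 !ler_norml => /andP[? ?] /andP[? ?]; lra.
Qed.

(* Any unit [w] yields the subproblem point [(w, s, s')] with [s] and [s'] the
   averages of [w] over the two normalized distributions, whose objective is
   0.  A negative optimum therefore forces [s + s' < alpha]. *)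
Lemma sub_opt_lt0_pd D alpha (mu : 'cV[R]_n1) (gamma : 'cV[R]_n2) :
  (forall j, norm2 (col j P) <= D) -> (forall j, norm2 (col j Q) <= D) ->
  nonneg mu -> nonneg gamma -> 0 < total mu -> 0 < total gamma ->
  (forall x, sub_feasible D alpha x -> sub_obj P Q mu gamma x < 0) ->
  let y := PdPt ((total mu)^-1 *: mu) ((total gamma)^-1 *: gamma) in
  pd_feasible y /\ pd_obj P Q y <= alpha.
Proof.
move=> PD QD mu0 ga0 m1 m2 neg y.
have fy : pd_feasible y.
  split; rewrite ?totalZ ?mulVf ?gt_eqF // => i; rewrite mxE mulr_ge0 //.
    by rewrite invr_ge0 ltW.
  by rewrite invr_ge0 ltW.
split=> //; apply: norm2_le_of_dot => w w1.
case: fy => t1 t2 p1 p2.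
have := dot_mulmx_bound PD p1 w1; have := dot_mulmx_bound QD p2 w1.
rewrite t1 t2 !mul1r !ler_norml dotBl.
set a := dot (P *m _) w; set b := dot (Q *m _) w.
move=> /andP[? ?] /andP[? ?]; case: leP => // ab; exfalso.
have /neg : sub_feasible D alpha (SvmPt w a (- b)) by split=> //=; lra.
rewrite /sub_obj /= dotBl /a /b /= -!scalemxAr !dotZl.
by rewrite mulrN !mulVKf ?gt_eqF //; lra.
Qed.

End Points.

(** * Potential analysis of the multiplicative weights *)

Section Hedge.
Variables (R : realType) (d n1 n2 : nat).
Variables (P : 'M[R]_(d, n1)) (Q : 'M[R]_(d, n2)).
Implicit Types (x acc : svm_pt R d).
Notation n := (n1 + n2)%N.
Notation margins := (margins P Q).

Definition exp_weights (lam : R) x : 'cV[R]_n :=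
  \col_i expR (- (lam * margins x i 0)).

Definition gibbs (lam : R) x : 'cV[R]_n :=
  (total (exp_weights lam x))^-1 *: exp_weights lam x.

Hypothesis n1_gt0 : (0 < n1)%N.

Lemma exp_weights0 lam : exp_weights lam (SvmPt 0 0 0) = const_mx 1.
Proof.
have -> : SvmPt 0 0 0 = pt_scale 0 (SvmPt 0 0 0) :> svm_pt R d.
  by rewrite /pt_scale scale0r mul0r.
apply/colP => i; rewrite [RHS]mxE [LHS]mxE margins_scale [X in lam * X]mxE.
by rewrite mul0r mulr0 oppr0 expR0.
Qed.

Lemma total_const_mx m (a : R) : total (const_mx a : 'cV_m) = a *+ m.
Proof.
rewrite /total (eq_bigr (fun=> a)) ?sumr_const ?card_ord // => i _.
by rewrite mxE.
Qed.

Lemma total_gt0 m (v : 'cV[R]_m) :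
  (0 < m)%N -> (forall i, 0 < v i 0) -> 0 < total v.
Proof.
case: m v => // m v _ v0; rewrite /total big_ord_recl ltr_wpDr //.
by apply: sumr_ge0 => i _; exact: ltW.
Qed.

Lemma exp_weights_add lam x x' i :
  exp_weights lam (pt_add x x') i 0 =
    exp_weights lam x i 0 * expR (- (lam * margins x' i 0)).
Proof.
rewrite [LHS]mxE margins_add [X in lam * X]mxE mulrDr opprD expRD.
by rewrite [exp_weights lam x i 0]mxE.
Qed.

Lemma exp_weights_gt0 lam x i : 0 < exp_weights lam x i 0.
Proof. by rewrite mxE expR_gt0. Qed.

Lemma total_exp_weights_gt0 lam x : 0 < total (exp_weights lam x).
Proof.
by apply: total_gt0 (@exp_weights_gt0 lam x); rewrite addn_gt0 n1_gt0.
Qed.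

Lemma gibbs_gt0 lam x i : 0 < gibbs lam x i 0.
Proof.
by rewrite mxE mulr_gt0 ?invr_gt0 ?exp_weights_gt0 ?total_exp_weights_gt0.
Qed.

(** With [u = lam * margins x' i 0], each weight is multiplied by
    [expR (- u) <= 1 - u + (lam * rho) ^+ 2]. Summed over [i], the linear terms contribute a
    nonpositive amount by the last hypothesis, and [1 + z <= expR z] finishes. *)
Lemma potential_step lam rho x x' : 0 <= lam -> lam * rho <= 1 / 4 ->
  (forall i, - rho <= margins x' i 0 <= rho) ->
  0 <= dot (gibbs lam x) (margins x') ->
  total (exp_weights lam (pt_add x x')) <=
    total (exp_weights lam x) * expR ((lam * rho) ^+ 2).
Proof.
move=> lam0 small bnd p0; have T0 := total_exp_weights_gt0 lam x.
have e0 : 0 <= dot (exp_weights lam x) (margins x').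
  by move: p0; rewrite dotZl pmulr_rge0 // invr_gt0.
apply: (@le_trans _ _ (total (exp_weights lam x) * (1 + (lam * rho) ^+ 2)));
  last by rewrite ler_pM2l // expR_ge1Dx.
apply: (@le_trans _ _ (total (exp_weights lam x) * (1 + (lam * rho) ^+ 2) -
    lam * dot (exp_weights lam x) (margins x'))); last first.
  by rewrite gerBl mulr_ge0.
rewrite mulr_suml mulr_sumr -sumrB; apply: ler_sum => i _.
rewrite exp_weights_add.
have w0 := exp_weights_gt0 lam x i.
rewrite mulrCA -mulrBr ler_pM2l //.
have /andP[b1 b2] := bnd i.
have q1 : - (lam * rho) <= lam * margins x' i 0 by rewrite -mulrN ler_wpM2l.
have q2 : lam * margins x' i 0 <= lam * rho by rewrite ler_wpM2l.
apply: le_trans (expR_le_quadratic _) _; first by lra.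
by nra.
Qed.

Section Invariant.
Variables (D alpha eta : R).
Hypotheses (P_le : forall j, norm2 (col j P) <= D)
           (Q_le : forall j, norm2 (col j Q) <= D).
Hypotheses (D_gt0 : 0 < D) (alpha_bounds : 0 < alpha <= 2 * D).
Hypotheses (eta_bounds : 0 < eta <= 1 / 4).
Let lam := eta / (2 * D).

(* [acc] is a sum of [m] subproblem solutions; the first condition, at
   [g = sw acc], gives [norm2 (sw acc) <= m] and is additive as it stands. *)
Definition hedge_inv (m : nat) acc : Prop :=
  [/\ forall g, dot g (sw acc) <= m%:R * norm2 g,
      m%:R * alpha <= svm_obj acc &
      total (exp_weights lam acc) <= n%:R * expR (m%:R * eta ^+ 2)].

Lemma hedge_inv0 : hedge_inv 0 (SvmPt 0 0 0).
Proof.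
split=> [g||]; rewrite ?mul0r /svm_obj /= ?dot0r ?addr0 //.
by rewrite expR0 mulr1 exp_weights0 total_const_mx.
Qed.

Lemma hedge_invS m acc x :
  hedge_inv m acc -> sub_feasible D alpha x ->
  0 <= dot (gibbs lam acc) (margins x) -> hedge_inv m.+1 (pt_add acc x).
Proof.
move=> [dot_acc obj_acc pot_acc] [sx w1 s1D s2D] p0.
have lamE : lam * (2 * D) = eta by rewrite /lam divfK // mulf_neq0 // gt_eqF.
case/andP: alpha_bounds => a0 a1; case/andP: eta_bounds => eta0 eta1.
split.
- move=> g; rewrite dotDr -natr1 mulrDl mul1r lerD //.
  exact: dot_le_norm.
- by rewrite -natr1 mulrDl mul1r; move: obj_acc; rewrite /svm_obj /=; lra.
apply: (le_trans (potential_step (rho := 2 * D) _ _ _ p0)).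
- by rewrite /lam divr_ge0 ?ltW // mulr_gt0.
- by rewrite lamE.
(* The lower bounds [- D] on the offsets come from their sum being at least [alpha > 0] while each
   is at most [D]. *)
- by move=> i; apply: margins_bound => //; try (apply/andP; split); lra.
by rewrite lamE -natr1 mulrDl mul1r expRD mulrA ler_wpM2r // ltW // expR_gt0.
Qed.

(** A single weight is at most the whole potential, so with [ln n = T * eta ^+ 2] every summed
    margin is at least [- (4 * D * T * eta)]. Dividing by [T] leaves a violation of at most
    [4 * D * eta <= ea / 2], which the shift of the offsets absorbs. *)
Lemma hedge_inv_feasible T ea acc : (0 < T)%N -> 0 < ea ->
  ln n%:R = T%:R * eta ^+ 2 -> 8 * D * eta <= ea -> hedge_inv T acc ->
  let avg := pt_scale T%:R^-1 acc in
  let x := SvmPt (sw avg) (s1 avg - ea / 2) (s2 avg - ea / 2) in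
  svm_feasible P Q x /\ alpha - ea <= svm_obj x.
Proof.
move=> T0 ea0 lnn eta_small [dot_acc obj_acc pot_acc] avg x.
have Tp : 0 < T%:R :> R by rewrite ltr0n.
case/andP: eta_bounds => eta0 eta1.
have n0 : 0 < n%:R :> R by rewrite ltr0n addn_gt0 n1_gt0.
split; last first.
  have : alpha <= T%:R^-1 * svm_obj acc by rewrite mulrC ler_pdivlMr // mulrC.
  by rewrite /svm_obj mulrDr /=; lra.
apply: svm_feasible_margins => [i|].
  rewrite margins_shift margins_scale mxE.
  have : - (lam * margins acc i 0) <= ln (n%:R * expR (T%:R * eta ^+ 2)).
    rewrite -ler_expR lnK ?posrE ?mulr_gt0 ?expR_gt0 //.
    apply: le_trans pot_acc; rewrite /total (bigD1 i) //= [X in X + _]mxE.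
    by rewrite lerDl sumr_ge0 // => j _; exact/ltW/exp_weights_gt0.
  rewrite lnM ?posrE ?expR_gt0 // expRK lnn.
  set z := margins acc i 0 => h.
  have {}h : - (2 * D * (2 * (T%:R * eta))) <= z.
    rewrite -(ler_pM2l (_ : 0 < lam)); last by rewrite divr_gt0 ?mulr_gt0.
    suff -> : lam * - (2 * D * (2 * (T%:R * eta))) = - (2 * (T%:R * eta ^+ 2)).
      by lra.
    by rewrite /lam; field; rewrite gt_eqF.
  have : T%:R^-1 * - (2 * D * (2 * (T%:R * eta))) <= T%:R^-1 * z.
    by rewrite ler_pM2l ?invr_gt0.
  have -> : T%:R^-1 * - (2 * D * (2 * (T%:R * eta))) = - (4 * D * eta).
    by field; rewrite gt_eqF.
  by lra.
case: (ltrgtP 0 (norm2 (sw x))) (norm2_ge0 (sw x)) => // [g0|<-] _; last lra.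
(* The first invariant at [g = sw x] bounds the squared norm of [sw x] by its norm. *)
rewrite -(ler_pM2l g0) mulr1 -expr2 norm2_sqr {2}/x /= dotZr mulrC.
by rewrite ler_pdivrMr // mulrC.
Qed.

End Invariant.

(** Optimality of the closed form turns the sign of one computed value into the dichotomy of the
    test: a (PD) certificate, or a point with nonnegative weighted margin. *)
Lemma val_sub_solve D alpha (mu : 'cV[R]_n1) (gamma : 'cV[R]_n2) :
  nonneg mu -> nonneg gamma -> 0 < total mu -> 0 < total gamma ->
  (forall j, norm2 (col j P) <= D) -> (forall j, norm2 (col j Q) <= D) ->
  alpha <= 2 * D ->
  let xv := val (sub_solve P Q D alpha mu gamma) in
  if xv.2 < 0 then
    let y := PdPt ((total mu)^-1 *: mu) ((total gamma)^-1 *: gamma) in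
    pd_feasible y /\ pd_obj P Q y <= alpha
  else sub_feasible D alpha xv.1 /\
    0 <= dot (col_mx mu gamma) (margins xv.1).
Proof.
move=> mu0 ga0 m1 m2 PD QD aD xv.
have [] := sub_solve_optimal P Q mu0 ga0 aD; rewrite -/xv => h1 h2 h3.
case: ifP => [neg|/negbT]; last by rewrite -leNgt -sub_obj_margins -h2.
apply: sub_opt_lt0_pd => // x /h3 hx; rewrite -/xv in hx.
exact: le_lt_trans hx neg.
Qed.

End Hedge.

(** * Values and operation counts of the vector primitives *)

Section Costs.
Variables (R : realType) (d n1 n2 : nat).
Implicit Types (m n : nat).

Lemma val_mulmx m n (A : 'M[R]_(m, n)) v : val (t_mulmx A v) = A *m v.
Proof. by apply/colP => i; rewrite !mxE. Qed.

Lemma val_scaledown n (v : 'cV[R]_n) a : val (t_scaledown v a) = a^-1 *: v.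
Proof. by apply/colP => i; rewrite !mxE mulrC. Qed.

Lemma cost_vec n (f : 'I_n -> tm R) c :
  (forall i, cost (f i) = c) -> cost (t_vec f) = (n * c)%N.
Proof.
by move=> fc; rewrite /= (eq_bigr (fun=> c)) // sum_nat_const card_ord.
Qed.

Lemma cost_sum n (f : 'I_n -> tm R) c :
  (forall i, cost (f i) = c) -> cost (t_sum f) = (n * c.+1)%N.
Proof.
move=> fc; rewrite /= (eq_bigr (fun=> c.+1)) => [|i _]; last by rewrite fc.
by rewrite sum_nat_const card_ord.
Qed.

Lemma cost_max n (f : 'I_n -> tm R) c :
  (forall i, cost (f i) = c) -> cost (t_max f) = (n * c.+1)%N.
Proof. exact: cost_sum. Qed.

Lemma cost_dot n (u v : 'cV[R]_n) : cost (t_dot u v) = (n * 2)%N.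
Proof. exact: cost_sum. Qed.

Lemma cost_norm n (v : 'cV[R]_n) : cost (t_norm v) = (n * 2).+1.
Proof. by rewrite /= -[X in X.+1]/(cost (t_dot v v)) cost_dot. Qed.

Lemma cost_mulmx m n (A : 'M[R]_(m, n)) v :
  cost (t_mulmx A v) = (m * (n * 2))%N.
Proof. by apply: cost_vec => i; exact: cost_sum. Qed.

Lemma cost_total n (v : 'cV[R]_n) : cost (t_total v) = n.
Proof. by rewrite (@cost_sum _ _ 0) ?muln1. Qed.

Lemma cost_scaledown n (v : 'cV[R]_n) a : cost (t_scaledown v a) = n.
Proof. by rewrite (@cost_vec _ _ 1) ?muln1. Qed.

Lemma cost_bind A B (e : tm A) (k : A -> tm B) :
  cost (bind e k) = (cost e + cost (k (val e)))%N.
Proof. by []. Qed.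

Lemma val_bind A B (e : tm A) (k : A -> tm B) :
  val (bind e k) = val (k (val e)).
Proof. by []. Qed.

End Costs.

(** * Cost and correctness of the iteration loop *)

Section Iterations.
Variables (R : realType) (d n1 n2 : nat).
Variables (P : 'M[R]_(d, n1)) (Q : 'M[R]_(d, n2)).
Notation n := (n1 + n2)%N.

Lemma cost_sub_solve D alpha mu gamma :
  (cost (sub_solve P Q D alpha mu gamma) <=
    2 * (n * d) + 6 * d + n + 8)%N.
Proof.
rewrite /sub_solve !cost_bind !cost_mulmx.
rewrite (@cost_vec _ _ _ 1) // cost_norm !cost_total.
rewrite -/(@t_dot R d).
set w := (if _ then _ else _).
(* Normalizing costs [d] divisions and the zero vector is free; only this branch makes the cost
   vary. *)
have : (cost w <= d)%N by rewrite /w; case: ifP; rewrite ?cost_scaledown.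
rewrite /= !(big_const, card_ord) !iter_addn.
nia.
Qed.

(** The factor [t] in the exponent undoes the averaging, so the new weights depend only on the sum
    of the subproblem solutions. *)
Lemma val_weights eta rho t x :
  val (weights P Q eta rho t x) =
    gibbs P Q (eta / rho) (pt_scale t%:R x).
Proof.
have E : val (\vec_i (t_exp (- ($(eta * t%:R / rho) *
    $((margins P Q x) i 0)))))%tm =
    exp_weights P Q (eta / rho) (pt_scale t%:R x).
  apply/colP => i; rewrite mxE [RHS]mxE margins_scale.
  by rewrite [X in _ / _ * X]mxE /= mulrA (mulrAC eta).
rewrite /gibbs -E -val_scaledown.
rewrite /weights.
have -> : margins P Q x = col_mx
  (\col_i ((val (t_mulmx P^T (sw x))) i 0 - s1 x))
  (\col_i (- (val (t_mulmx Q^T (sw x))) i 0 - s2 x)).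
  rewrite /margins !val_mulmx; congr col_mx; apply/colP => i.
    by rewrite [LHS]mxE [RHS]mxE; congr (_ + _); rewrite !mxE.
  by rewrite [LHS]mxE [RHS]mxE; congr (_ + _); rewrite mxE // mxE.
by [].
Qed.

Lemma cost_weights eta rho t x :
  (cost (weights P Q eta rho t x) <= 2 * (n * d) + 8 * n + 3)%N.
Proof.
rewrite /weights !cost_bind !cost_mulmx.
rewrite (@cost_vec _ _ _ 1) // (@cost_vec _ _ _ 2) // (@cost_vec _ _ _ 3) //.
by rewrite cost_total cost_scaledown /=; nia.
Qed.

(** The final [3] pays for the halving and the two subtractions of the output. An early exit fits in
    the budget of the iteration where it occurs. *)
Lemma cost_iterations D alpha ea eta rho k t p acc avg :
  (cost (iterations P Q D alpha ea eta rho k t p acc avg) <=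
    k * (4 * (n * d) + 10 * n + 8 * d + 17) + 3)%N.
Proof.
elim: k t p acc avg => [|k IH] t p acc avg; first by [].
rewrite /iterations -/iterations cost_bind.
have := cost_sub_solve D alpha (usubmx p) (dsubmx p).
set xv := val (sub_solve _ _ _ _ _ _); set c := cost (sub_solve _ _ _ _ _ _).
move=> h1; rewrite cost_bind; case: (val _).
  by rewrite !cost_bind !cost_total !cost_scaledown /=; nia.
rewrite 8!cost_bind (@cost_vec _ _ _ 1) // cost_scaledown.
set cw := cost (weights _ _ _ _ _ _).
have h2 : (cw <= 2 * (n * d) + 8 * n + 3)%N by exact: cost_weights.
set r := cost (_ t.+1 _ _ _).
have h3 : (r <= k * (4 * (n * d) + 10 * n + 8 * d + 17) + 3)%N by exact: IH.
rewrite /=; lia.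
Qed.

(** Induction on the remaining iterations [k], after [m] completed ones; for this, weights and
    average are both written as functions of the sum [acc]. *)
Lemma iterations_correct D alpha ea eta T :
  (0 < n1)%N -> (0 < n2)%N ->
  (forall j, norm2 (col j P) <= D) -> (forall j, norm2 (col j Q) <= D) ->
  0 < D -> 0 < alpha <= 2 * D -> 0 < eta <= 1 / 4 -> (0 < T)%N -> 0 < ea ->
  ln n%:R = T%:R * eta ^+ 2 -> 8 * D * eta <= ea ->
  forall k m acc, (m + k)%N = T -> hedge_inv P Q D alpha eta m acc ->
  match val (iterations P Q D alpha ea eta (2 * D) k m.+1
    (gibbs P Q (eta / (2 * D)) acc) acc (pt_scale m%:R^-1 acc)) with
  | Below_guess y => pd_feasible y /\ pd_obj P Q y <= alpha
  | Solution x => svm_feasible P Q x /\ alpha - ea <= svm_obj x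
  end.
Proof.
move=> n10 n20 PD QD D0 al0 et0 T0 ea0 lnn small.
elim=> [|k IH] m acc mk inv.
  rewrite addn0 in mk; rewrite mk in inv *.
  exact: hedge_inv_feasible inv.
set p := gibbs _ _ _ _.
have p_gt0 i : 0 < p i 0 by exact: gibbs_gt0.
have mu0 i : 0 < usubmx p i 0 by rewrite mxE.
have ga0 i : 0 < dsubmx p i 0 by rewrite mxE.
have [a0 a1] := andP al0.
have := val_sub_solve (fun i => ltW (mu0 i)) (fun i => ltW (ga0 i))
  (total_gt0 n10 mu0) (total_gt0 n20 ga0) PD QD a1.
rewrite vsubmxK /iterations -/iterations val_bind.
set xv := val (sub_solve _ _ _ _ _ _).
rewrite val_bind [val (t_lt _ _)]/=; case: ifP => [_ [fy hy]|_ [fx x0]].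
  by rewrite !val_bind !val_scaledown.
rewrite 8!val_bind val_weights val_scaledown.
set w := val (\vec_ _ _)%tm.
have wE : w = sw acc + sw xv.1 by apply/colP => i; rewrite !mxE.
rewrite wE; set a := val (_ / _)%tm; set b := val (_ / _)%tm.
(* Multiplying the new average by [m.+1] recovers the new sum, which restores the form required by
   the induction hypothesis. *)
have [-> ->] : pt_scale m.+1%:R (SvmPt (m.+1%:R^-1 *: sw (pt_add acc xv.1)) a b)
    = pt_add acc xv.1 /\
  SvmPt (m.+1%:R^-1 *: (sw acc + sw xv.1)) a b =
    pt_scale m.+1%:R^-1 (pt_add acc xv.1).
  rewrite /pt_scale /pt_add /a /b /=; split; congr SvmPt.
  - by rewrite scalerA mulfV ?pnatr_eq0 // scale1r.
  - by rewrite mulrC divfK ?pnatr_eq0.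
  - by rewrite mulrC divfK ?pnatr_eq0.
  - by rewrite mulrC.
  - by rewrite mulrC.
apply: (IH m.+1 (pt_add acc xv.1)); first by rewrite addSnnS.
exact: (hedge_invS n10 PD QD D0 al0 et0 inv fx x0).
Qed.
End Iterations.

(** * A single feasibility test: its parameters, outcome and cost *)

Lemma natr_abs_ceil (R : realType) (x : R) :
  0 < x -> x <= `|Num.ceil x|%N%:R < x + 1.
Proof.
move=> x0; have c0 : 0 < Num.ceil x by rewrite ceil_gt0.
rewrite -[`|_|%N%:R]/(`|Num.ceil x|%N%:Z%:~R) gez0_abs ?(ltW c0) //.
by have := ceil_itv x; rewrite intrB; lra.
Qed.

(** Holds because [expR (1 / 4) <= 21 / 16 < 2]. Keeping [ln n] away from zero lets rounding and
    lower-order costs be absorbed in the main term. *)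
Lemma ln_nat_ge (R : realType) (n : nat) : (1 < n)%N -> 1 / 4 <= ln n%:R :> R.
Proof.
move=> n1; have n0 : 0 < n%:R :> R by rewrite ltr0n ltnW.
rewrite -ler_expR lnK ?posrE //.
apply: le_trans (expR_le_quadratic (lexx _)) _.
by have : 2 <= n%:R :> R by [rewrite ler_nat]; lra.
Qed.

(** Since [n <= n * d] and, for [n >= 2], [2 * d <= n * d], one iteration costs at most
    [35 * (n * d)]. The term [(2 * T).+1] is the ceiling found by counting. *)
Lemma test_cost_le (n d T c : nat) :
  (0 < d)%N -> (1 < n)%N -> (0 < T)%N ->
  (c <= T * (4 * (n * d) + 10 * n + 8 * d + 17) + 3 ->
  1 + (1 + (2 + (5 + (2 * T).+1 + (3 + (n * 2 + c))))) <= 60 * n * d * T)%N.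
Proof.
move=> d0 n1 T0.
have nd : (n <= n * d)%N by rewrite leq_pmulr.
have dn : (2 * d <= n * d)%N by rewrite leq_mul2r n1 orbT.
rewrite -(mulnA 60 n d) -mulnA (mulnC (n * d)%N); move: (n * d)%N nd dn
  => m nd dn.
have : (T * (4 * m + 10 * n + 8 * d + 17) <= T * (35 * m))%N.
  by rewrite leq_mul2l; lia.
have : (T * 1 <= T * m)%N by rewrite leq_mul2l; lia.
have : (m <= T * m)%N by rewrite leq_pmull.
by rewrite (mulnCA T 35); lia.
Qed.

Section Test.
Variables (R : realType) (d n1 n2 : nat).
Variables (P : 'M[R]_(d, n1)) (Q : 'M[R]_(d, n2)).
Notation n := (n1 + n2)%N.

(** The uniform starting vector is the Gibbs distribution of the empty sum, so the first iteration
    is not a special case. *)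
Lemma gibbs0 lam :
  gibbs P Q lam (SvmPt 0 0 0) = \col_i (1 / n%:R).
Proof.
apply/colP => i; rewrite /gibbs exp_weights0 total_const_mx.
by rewrite !mxE mulrC.
Qed.

Lemma feasibility_test_spec (D alpha eps' : R) :
  (0 < d)%N -> (0 < n1)%N -> (0 < n2)%N ->
  (forall j, norm2 (col j P) <= D) -> (forall j, norm2 (col j Q) <= D) ->
  0 < D -> 0 < alpha <= 2 * D -> 0 < eps' * alpha ->
  eps' * alpha <= 2 * D / 3 ->
  match val (feasibility_test P Q D alpha eps') with
  | Below_guess y => pd_feasible y /\ pd_obj P Q y <= alpha
  | Solution x => svm_feasible P Q x /\ alpha - eps' * alpha <= svm_obj x
  end /\
  (cost (feasibility_test P Q D alpha eps'))%:R <=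
    60 * 128 * n%:R * d%:R * (D ^+ 2 * ln n%:R / (eps' * alpha) ^+ 2).
Proof.
move=> d0 n10 n20 PD QD D0 al0; set ea := eps' * alpha => ea0 ea1.
pose X : R := 4 * 2 ^+ 2 * ((2 * D) * (2 * D)) * ln n%:R / (ea * ea).
pose T := `|Num.ceil X|%N; pose eta : R := Num.sqrt (ln n%:R / T%:R).
have nn : (1 < n)%N by lia.
have lnn := ln_nat_ge R nn.
(* This makes rounding harmless: [T < X + 1 <= 2 * X], whence the [128 = 2 * 64] in the cost. *)
have X1 : 1 <= X.
  rewrite /X ler_pdivlMr ?(mulr_gt0 ea0 ea0) // mul1r.
  have : ea * ea <= (2 * D / 3) * (2 * D / 3) by rewrite ler_pM // ltW.
  have : 4 * 2 ^+ 2 * (2 * D * (2 * D)) * (1 / 4) <=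
      4 * 2 ^+ 2 * (2 * D * (2 * D)) * ln n%:R.
    by rewrite ler_wpM2l // !mulr_ge0 // ltW.
  have : 0 < D * D by rewrite mulr_gt0.
  by move=> *; nra.
have X0 : 0 < X by lra.
have /andP[XT TX] := natr_abs_ceil X0; rewrite -/T in XT TX.
have TR0 : 0 < T%:R :> R by lra.
have T0 : (0 < T)%N by rewrite ltr0n in TR0.
have eta2 : eta ^+ 2 = ln n%:R / T%:R by rewrite sqr_sqrtr // divr_ge0 //; lra.
have eta0 : 0 < eta by rewrite sqrtr_gt0 divr_gt0 //; lra.
have small : 8 * D * eta <= ea.
  have De0 : 0 <= 8 * D * eta by rewrite !mulr_ge0 // ltW.
  rewrite -(@ler_pXn2r _ 2) // ?nnegrE ?(ltW ea0) //.
  rewrite exprMn eta2 [leLHS]mulrA ler_pdivrMr //.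
  have -> : (8 * D) ^+ 2 * ln n%:R = ea ^+ 2 * X.
    by rewrite /X; field; rewrite gt_eqF.
  by rewrite ler_wpM2l // sqr_ge0.
have eta1 : eta <= 1 / 4.
  by rewrite -(@ler_pM2l _ (8 * D)) ?mulr_gt0 //; lra.
have XE : X = 64 * (D ^+ 2 * ln n%:R / ea ^+ 2).
  by rewrite /X; field; rewrite gt_eqF.
split.
  have eta14 : 0 < eta <= 1 / 4 by rewrite eta0.
  have lnE : ln n%:R = T%:R * eta ^+ 2 by rewrite eta2 mulrC divfK ?gt_eqF.
  have := iterations_correct n10 n20 PD QD D0 al0 eta14 T0 ea0 lnE small
    (add0n T) (hedge_inv0 _ _ _ _ _).
  (* The initial average is a zero point scaled by the inverse of [0], so the value of that inverse
     is immaterial. *)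
  rewrite gibbs0 (_ : pt_scale _ _ = SvmPt 0 0 0) //.
  by rewrite /pt_scale /= scaler0 mulr0.
have : (cost (feasibility_test P Q D alpha eps') <= 60 * n * d * T)%N.
  rewrite /feasibility_test 6!cost_bind (@cost_vec _ _ _ 2) //.
  set c := cost (iterations _ _ _ _ _ _ _ _ _ _ _ _).
  have : (c <= T * (4 * (n * d) + 10 * n + 8 * d + 17) + 3)%N.
    exact: cost_iterations.
  exact: test_cost_le.
rewrite -(ler_nat R) => /le_trans; apply.
have -> : 60 * 128 * n%:R * d%:R * (D ^+ 2 * ln n%:R / ea ^+ 2) =
  60 * n%:R * d%:R * (2 * X) by rewrite XE; ring.
by rewrite !natrM ler_wpM2l ?mulr_ge0 //; lra.
Qed.
End Test.

(** * The search over guesses and its total cost *)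

Section Search.
Variables (R : realType) (d n1 n2 : nat).
Variables (P : 'M[R]_(d, n1)) (Q : 'M[R]_(d, n2)).
Notation n := (n1 + n2)%N.

(** A supremum is meaningful only for a bounded set; weak duality against [y0] supplies the
    bound. *)
Lemma svm_obj_le_opt x (y0 : pd_pt R n1 n2) : pd_feasible y0 ->
  svm_feasible P Q x -> svm_obj x <= svm_opt P Q.
Proof.
move=> fy fx; apply: ub_le_sup; last by exists x.
by exists (pd_obj P Q y0) => _ [z fz <-]; exact: weak_duality.
Qed.

Lemma svm_opt_le_pd_obj (y : pd_pt R n1 n2) :
  pd_feasible y -> svm_opt P Q <= pd_obj P Q y.
Proof.
move=> fy; apply: ge_sup.
  by exists (svm_obj (SvmPt (0 : 'cV[R]_d) 0 0)), (SvmPt 0 0 0);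
    first exact: svm_feasible0.
by move=> _ [z fz <-]; exact: weak_duality.
Qed.

Lemma pd_opt_le (y : pd_pt R n1 n2) :
  pd_feasible y -> pd_opt P Q <= pd_obj P Q y.
Proof.
move=> fy; apply: ge_inf; last by exists y.
by exists 0 => _ [z fz <-]; exact: norm2_ge0.
Qed.

Lemma svm_opt_le_pd_opt (y0 : pd_pt R n1 n2) :
  pd_feasible y0 -> svm_opt P Q <= pd_opt P Q.
Proof.
move=> fy; apply: lb_le_inf; first by exists (pd_obj P Q y0), y0.
by move=> _ [z fz <-]; exact: svm_opt_le_pd_obj.
Qed.

(** Each end of the interval is certified by a stored solution, so weak duality places the optimum
    between them. *)
Definition search_inv D (st : search_state R d n1 n2) : Prop :=
  [/\ 0 <= lo st < up st /\ up st <= 2 * D,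
      svm_feasible P Q (svm_sol st), lo st <= svm_obj (svm_sol st),
      pd_feasible (pd_sol st) & pd_obj P Q (pd_sol st) <= up st].

Let gap (st : search_state R d n1 n2) := up st - lo st.

Lemma search_body_spec D st :
  (0 < d)%N -> (0 < n1)%N -> (0 < n2)%N ->
  (forall j, norm2 (col j P) <= D) -> (forall j, norm2 (col j Q) <= D) ->
  0 < D -> search_inv D st ->
  let st' := val (search_body P Q D st) in
  [/\ search_inv D st', gap st' = 2 / 3 * gap st &
    (cost (search_body P Q D st) + 3)%:R <=
      100 * 128 * 9 * n%:R * d%:R * (D ^+ 2 * ln n%:R / gap st ^+ 2)].
Proof.
move=> d0 n10 n20 PD QD D0 [[/andP[lo0 lou] upD] fx ox fy oy].
rewrite /gap; set g := up st - lo st.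
have g0 : 0 < g by rewrite subr_gt0.
pose alpha := up st - g / 3; pose eps' := g / 3 / alpha.
have al0 : 0 < alpha by rewrite /alpha /g; lra.
have eaE : eps' * alpha = g / 3 by rewrite divfK ?gt_eqF.
have := @feasibility_test_spec _ _ _ _ P Q D alpha eps' d0 n10 n20 PD QD D0.
rewrite eaE => -[]; [|lra|by rewrite /g; lra|].
  by rewrite al0 /alpha; lra.
rewrite /search_body 3!cost_bind 3!val_bind.
rewrite -[feasibility_test _ _ _ _ _]/(feasibility_test P Q D alpha eps').
set F := feasibility_test _ _ _ _ _; rewrite (val_bind F) (cost_bind F).
move=> res cF.
have nd2 : 2 <= n%:R * d%:R :> R by rewrite -natrM ler_nat; nia.
have lnn : 1 / 4 <= ln n%:R :> R by apply: ln_nat_ge; lia.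
set B := D ^+ 2 * ln n%:R / g ^+ 2.
have B1 : 1 / 16 <= B.
  rewrite ler_pdivlMr ?exprn_gt0 //.
  have : D ^+ 2 * (1 / 4) <= D ^+ 2 * ln n%:R by rewrite ler_wpM2l ?sqr_ge0.
  have : g ^+ 2 <= (2 * D) ^+ 2.
    by rewrite lerXn2r ?nnegrE; rewrite /g; lra.
  by rewrite exprMn; lra.
have {}cF : (cost F)%:R <= 60 * 128 * 9 * (n%:R * d%:R * B).
  apply: le_trans cF _; rewrite le_eqVlt; apply/orP; left; apply/eqP.
  by rewrite /B; field; rewrite gt_eqF.
have ndB : 1 / 8 <= n%:R * d%:R * B.
  by have : 2 * (1 / 16) <= n%:R * d%:R * B; [rewrite ler_pM|]; lra.
(* The factor [9] comes from [eps' * alpha = g / 3]. Raising [60] to [100] pays for the at most [9]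
   operations outside the test, stopping check included, because [n * d * B >= 1 / 8]. *)
have costE c : (c <= 2)%N ->
    (2 + (1 + (1 + (cost F + c))) + 3)%:R <=
      100 * 128 * 9 * n%:R * d%:R * B.
  have -> : 100 * 128 * 9 * n%:R * d%:R * B =
    100 * 128 * 9 * (n%:R * d%:R * B) by ring.
  rewrite -(ler_nat R); move: cF ndB; set M := n%:R * d%:R * B.
  by rewrite !natrD; lra.
clearbody F; case: (val F) res => [y [fy' oy']|x [fx' ox']].
  split; last exact: costE.
  - by split=> //=; rewrite -/alpha; split=> //; rewrite /alpha /g; lra.
  - by rewrite /= -/g /g; field.
have lE : (1 - eps') * alpha = alpha - g / 3 by rewrite mulrBl mul1r eaE.
split; last exact: costE.
- split=> //=; rewrite -/g -/alpha -/eps' lE //.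
  by split=> //; rewrite /alpha /g; lra.
- by rewrite /= -/g -/alpha -/eps' lE /alpha /g; field.
Qed.

(* The cost bound is a potential: with [s = 4/5 / gap^2], a step that shrinks
   the gap by 2/3 raises [s] by exactly [1 / gap^2]; [9/5 / e0^2] keeps the
   potential nonnegative down to [gap = 2/3 * e0].  [k] counts the at most
   [gap / (e0 / 3)] steps, each of which removes more than [e0 / 3]. *)
Lemma search_terminates (D e0 : R)
    (stop : search_state R d n1 n2 -> tm bool) :
  (0 < d)%N -> (0 < n1)%N -> (0 < n2)%N ->
  (forall j, norm2 (col j P) <= D) -> (forall j, norm2 (col j Q) <= D) ->
  0 < D -> 0 < e0 ->
  (forall st, cost (stop st) = 3%N) ->
  (forall st, search_inv D st -> val (stop st) = false -> e0 < gap st) ->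
  let K := 100 * 128 * 9 * n%:R * d%:R * (D ^+ 2 * ln n%:R) in
  forall k st, search_inv D st ->
  2 / 3 * e0 <= gap st -> gap st <= k%:R * (e0 / 3) ->
  exists c st',
    [/\ while_not stop (search_body P Q D) st c st', search_inv D st',
        val (stop st') = true &
        c%:R <= 3 + K * (9 / 5 / e0 ^+ 2 - 4 / 5 / gap st ^+ 2)].
Proof.
move=> d0 n10 n20 PD QD D0 e00 stop3 stopF K.
have lnn : 1 / 4 <= ln n%:R :> R by apply: ln_nat_ge; lia.
have K0 : 0 <= K by rewrite !mulr_ge0 ?sqr_ge0 //; lra.
elim=> [|k IH] st inv ge gk.
  by exfalso; rewrite mul0r in gk; lra.
case E : (val (stop st)); last first.
  have g1 := stopF _ inv E.
  have [inv' g' cb] := search_body_spec d0 n10 n20 PD QD D0 inv.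
  have [||c [st' [w' i' s' c']]] := IH _ inv'.
  - by rewrite g'; lra.
  - by rewrite g'; move: gk; rewrite -natr1; lra.
  exists (cost (stop st) + cost (search_body P Q D st) + c)%N, st'; split=> //.
    exact: while_not_step.
  have gE : 4 / 5 / gap (val (search_body P Q D st)) ^+ 2 =
      4 / 5 / gap st ^+ 2 + 1 / gap st ^+ 2.
    by rewrite g'; field; rewrite gt_eqF //; lra.
  rewrite gE in c'; rewrite stop3 natrD addnC.
  have KE : 100 * 128 * 9 * n%:R * d%:R * (D ^+ 2 * ln n%:R / gap st ^+ 2) =
    K * (1 / gap st ^+ 2) by rewrite /K; ring.
  by rewrite KE in cb; lra.
exists (cost (stop st)), st; split=> //; first exact: while_not_stop.
rewrite stop3 lerDl mulr_ge0 // subr_ge0.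
have gap_gt0 : 0 < gap st by lra.
rewrite ler_pdivrMr ?exprn_gt0 //.
rewrite mulrAC ler_pdivlMr ?exprn_gt0 //.
have : (2 / 3 * e0) ^+ 2 <= gap st ^+ 2 by rewrite lerXn2r ?nnegrE; lra.
by rewrite exprMn; lra.
Qed.
End Search.

(** * The complete algorithm and strong duality *)

Section Algorithm.
Variables (R : realType) (d n1 n2 : nat).
Variables (P : 'M[R]_(d, n1)) (Q : 'M[R]_(d, n2)).
Notation n := (n1 + n2)%N.
Notation OPT := (svm_opt P Q).
Notation D := (max_norm P Q).

Lemma norm2_colP_le j : norm2 (col j P) <= D.
Proof.
by rewrite /max_norm le_max (le_bigmax_cond 0 (fun j => norm2 (col j P))).
Qed.

Lemma norm2_colQ_le j : norm2 (col j Q) <= D.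
Proof.
by rewrite /max_norm le_max (le_bigmax_cond 0 (fun j => norm2 (col j Q))) ?orbT.
Qed.

Lemma val_max_norm : val (t_max_norm P Q) = D.
Proof. by rewrite /max_norm maxEle. Qed.

Lemma cost_max_norm : cost (t_max_norm P Q) = (n * (2 * d + 2) + 1)%N.
Proof.
rewrite /t_max_norm !cost_bind.
rewrite !(@cost_max _ _ _ (d * 2).+1) => [|j|j]; try exact: cost_norm.
by rewrite /=; lia.
Qed.

Lemma start_cost_le : (0 < d)%N -> (0 < n1)%N -> (0 < n2)%N ->
  (n * (2 * d + 2) + 1 + 1 + 3 <= 7 * (n * d))%N.
Proof. by nia. Qed.

(** The (PD) value is compared with the optimum of (SVM), because strong duality is deduced from
    this statement afterwards. *)
Lemma meta_algorithm_spec eps rule (y0 : pd_pt R n1 n2) :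
  (0 < n1)%N -> (0 < n2)%N -> 0 < OPT -> 0 < eps <= 1 -> pd_feasible y0 ->
  exists time x y,
    [/\ meta_algorithm P Q rule eps y0 time x y,
        svm_approx P Q eps x,
        pd_feasible y /\ pd_obj P Q y <= (1 + eps) * OPT &
        time%:R <= 10 ^+ 6 *
          (D ^+ 2 / OPT ^+ 2 * n%:R * d%:R * ln n%:R / eps ^+ 2)].
Proof.
move=> n10 n20 OPT0 /andP[eps0 eps1] fy0.
have objD := pd_obj_le_max_norm norm2_colP_le norm2_colQ_le fy0.
have opt_obj := svm_opt_le_pd_obj P Q fy0.
have D0 : 0 < D by lra.
(* In dimension [0] every norm vanishes, contradicting a positive optimum. *)
have d0 : (0 < d)%N.
  case: posnP => // d0; exfalso; have : 0 < pd_obj P Q y0 by lra.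
  rewrite /pd_obj /norm2 big1 ?sqrtr0 ?ltxx // => i.
  by exfalso; move: (ltn_ord i); rewrite [X in (_ < X)%N]d0.
pose e0 := eps * OPT / 2.
have e00 : 0 < e0 by rewrite divr_gt0 ?mulr_gt0.
have epsOPT : eps * OPT <= OPT by rewrite ler_piMl // ltW.
have inv_opt st : search_inv P Q D st -> lo st <= OPT <= up st.
  move=> [_ fx ox fy oy]; have := svm_obj_le_opt fy fx.
  by have := svm_opt_le_pd_obj P Q fy => *; lra.
pose stop := search_stop P Q rule eps.
have stop3 st : cost (stop st) = 3%N by [].
have stopE st : val (stop st) =
    (up st - lo st <= eps * (if rule is Exact_gap then OPT else lo st)) by [].
have stopF st : search_inv P Q D st -> val (stop st) = false ->
    e0 < up st - lo st.
  move=> /inv_opt/andP[o1 o2]; rewrite stopE => /negbT; rewrite -ltNge /e0.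
  case: rule {stop stop3 stopE}; first by lra.
  (* The gap exceeds [eps * lo st] and is at least [OPT - lo st >= eps * (OPT - lo st)]; adding the
     two shows that twice the gap exceeds [eps * OPT], hence the half in [e0]. *)
  have : eps * (OPT - lo st) <= 1 * (OPT - lo st) by rewrite ler_wpM2r //; lra.
  by lra.
pose st0 := SearchState 0 (2 * D) (SvmPt 0 0 0) y0 : search_state R d n1 n2.
have inv0 : search_inv P Q D st0.
  split=> //=.
  - by rewrite lexx mulr_gt0.
  - exact: svm_feasible0.
  - by rewrite /svm_obj addr0.
have [k gk] : exists k : nat, up st0 - lo st0 <= k%:R * (e0 / 3).
  exists (`|Num.ceil ((2 * D) / (e0 / 3))|%N); rewrite /= subr0.
  have e30 : 0 < e0 / 3 by rewrite divr_gt0.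
  rewrite -ler_pdivrMr //.
  have /natr_abs_ceil/andP[] // : 0 < 2 * D / (e0 / 3).
  by rewrite divr_gt0 // mulr_gt0.
have ge : 2 / 3 * e0 <= up st0 - lo st0 by rewrite /= /e0; lra.
have [c [st [w inv s hc]]] := search_terminates d0 n10 n20 norm2_colP_le
  norm2_colQ_le D0 e00 stop3 stopF inv0 ge gk.
have /andP[o1 o2] := inv_opt _ inv.
have gap_st : up st - lo st <= eps * OPT.
  move: s; rewrite stopE; case: (rule) => // /le_trans; apply.
  by rewrite ler_wpM2l // ltW.
case: inv => [[lou upD] fx ox fy oy].
exists (n * (2 * d + 2) + 1 + 1 + c)%N, (svm_sol st), (pd_sol st); split.
- exists c, st; split=> //.
    by move: w; rewrite /st0 -val_max_norm.
  by rewrite cost_bind cost_max_norm; congr (_ + c)%N.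
- by split=> //; lra.
- by split=> //; lra.
set nd : R := n%:R * d%:R.
pose Z := D ^+ 2 * ln n%:R / (eps * OPT) ^+ 2.
have -> : D ^+ 2 / OPT ^+ 2 * n%:R * d%:R * ln n%:R / eps ^+ 2 = nd * Z.
  by rewrite /Z /nd; field; rewrite !gt_eqF.
have lnn : 1 / 4 <= ln n%:R :> R by apply: ln_nat_ge; exact: leq_add n10 n20.
have Z1 : 1 / 16 <= Z.
  rewrite ler_pdivlMr ?exprn_gt0 ?mulr_gt0 //.
  have : D ^+ 2 * (1 / 4) <= D ^+ 2 * ln n%:R by rewrite ler_wpM2l ?sqr_ge0.
  have : (eps * OPT) ^+ 2 <= (2 * D) ^+ 2.
    by have := mulr_gt0 eps0 OPT0; rewrite lerXn2r ?nnegrE; lra.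
  by rewrite exprMn; lra.
have nd0 : 0 <= nd by rewrite mulr_ge0.
have ndZ : nd / 16 <= nd * Z by rewrite ler_wpM2l //; lra.
(* Here [36 / 5] is [9 / 5] times the [4] from squaring the half in [e0]. The product is [829440],
   and [nd <= 16 * (nd * Z)] fits the starting cost below [10 ^+ 6]. *)
have search_cost : c%:R <= 3 + 100 * 128 * 9 * (36 / 5) * (nd * Z).
  apply: le_trans hc _; rewrite lerD2l.
  set K := 100 * 128 * 9 * n%:R * d%:R * (D ^+ 2 * ln n%:R).
  have K0 : 0 <= K by rewrite !mulr_ge0 ?sqr_ge0 //; lra.
  apply: (@le_trans _ _ (K * (9 / 5 / e0 ^+ 2))).
    by rewrite ler_wpM2l // gerBl !divr_ge0 ?sqr_ge0.
  rewrite le_eqVlt; apply/orP; left; apply/eqP; rewrite /K /Z /nd /e0; field.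
  by rewrite !gt_eqF.
have start_cost : (n * (2 * d + 2) + 1 + 1)%:R + 3 <= 7 * nd.
  by rewrite /nd -natrM -natrD -natrM ler_nat start_cost_le.
rewrite natrD; lra.
Qed.

End Algorithm.

Theorem theorem7 (R : realType) :
  exists2 C : R, 0 < C &
  forall (d n1 n2 : nat) (P : 'M[R]_(d, n1)) (Q : 'M[R]_(d, n2))
    (eps : R) (rule : stop_rule) (y0 : pd_pt R n1 n2),
    (0 < n1)%N -> (0 < n2)%N -> 0 < svm_opt P Q ->
    0 < eps <= 1 -> pd_feasible y0 ->
    let n := (n1 + n2)%N in
    let OPT := svm_opt P Q in
    let E := max_norm P Q ^+ 2 / OPT ^+ 2 in
    pd_opt P Q = OPT /\
    exists (time : nat) (x : svm_pt R d) (y : pd_pt R n1 n2),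
      [/\ meta_algorithm P Q rule eps y0 time x y,
          svm_approx P Q eps x,
          pd_approx P Q eps y &
          time%:R <= C * (E * n%:R * d%:R * ln n%:R / eps ^+ 2)].
Proof.
exists (10 ^+ 6) => [|d n1 n2 P Q eps rule y0 n10 n20 OPT0 eps01 fy0 n OPT E].
  by rewrite exprn_gt0.
have dual : pd_opt P Q = OPT.
  apply/eqP; rewrite eq_le (svm_opt_le_pd_opt P Q fy0) andbT.
  apply/ler_addgt0Pr => e e0.
  (* The bound [1] keeps the tolerance admissible, and [e / OPT] makes the additive error [e' * OPT]
     at most [e]. *)
  pose e' := Num.min 1 (e / OPT).
  have e'0 : 0 < e' <= 1 by rewrite lt_min ltr01 divr_gt0 // ge_min lexx.
  have [_ [_ [y [_ _ [fy oy] _]]]] :=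
    meta_algorithm_spec Exact_gap n10 n20 OPT0 e'0 fy0.
  apply: le_trans (pd_opt_le P Q fy) _; apply: le_trans oy _.
  rewrite mulrDl mul1r lerD2l -ler_pdivlMr //.
  by rewrite ge_min lexx orbT.
split=> //.
have [time [x [y [alg ax [fy oy] ht]]]] :=
  meta_algorithm_spec rule n10 n20 OPT0 eps01 fy0.
by exists time, x, y; split=> //; split=> //; rewrite dual.
Qed.
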